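(* Given a system of ODEs $$\begin{aligned}X_t(t)&=-\kappa X(t)+f_1(X(t),Y(t))+e^{-t}g_1(X(t),Y(t)),\\ Y_t(t)&=\mu Y(t)+f_2(X(t),Y(t))+e^{-t}g_2(X(t),Y(t)),\end{aligned}$$ where $\mu>0>-\kappa$ and, for $i=1,2$, $\frac{f_i(X,Y)}{\sqrt{X^2+Y^2}}\to0$ as $(X,Y)\to(0,0)$ and $g_i\in O(\sqrt{X^2+Y^2})$ as $(X,Y)\to(0,0)$. Then for all positive $M_1,M_2$ and all $\delta\in(0,\kappa)$ there exist positive constants $\varepsilon_0$ and $T_0$ with the following significance: for any $\varepsilon\in(0,\varepsilon_0]$ and any $T\in[T_0,\infty)$ there is a solution curve $(X(t),Y(t))$ defined on $t\in[T,\infty)$ with initial condition $X(T)=\varepsilon$ and $(X,Y)\to(0,0)$ as $t\to\infty$. Furthermore, $$0\le X\le\varepsilon,\qquad -M_2X\le Y\le M_1X\qquad\text{for all }t\in[T,\infty),$$ and $X,Y\in O(e^{-(\kappa-\delta)t})$ as $t\to\infty$.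
   Context: $X,Y$ are real-valued functions of $t$, $f_i$ and $g_i$ ($i=1,2$) are real-valued functions of $(X,Y)$, and $\kappa,\mu$ are real constants. Subscript $t$ denotes $d/dt$. $h\in O(q)$ means $|h|\le \tilde C|q|$ near the indicated limit for some constant $\tilde C>0$.
   Formalization: The functions f_i and g_i are additionally assumed continuous in a neighbourhood of (0,0); for arbitrary real-valued functions the claim fails, e.g. κ=1, f_1=X² for rational X and 0 otherwise, f_2=g_1=g_2=0. *)

(* Defs.v *)
From HB Require Import structures.
From mathcomp Require Import all_boot all_order all_algebra.
From mathcomp Require Import all_classical all_reals all_analysis.

Set Implicit Arguments.
Unset Strict Implicit.
Unset Printing Implicit Defensive.

Import Order.TTheory GRing.Theory Num.Theory.
Import numFieldNormedType.Exports.
Local Open Scope classical_set_scope.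
Local Open Scope ring_scope.

(* The product R * R carries the sup norm in the library, so the Euclidean
   one has to be written out. *)
Definition enorm (R : realType) (z : R * R) : R :=
  Num.sqrt (z.1 ^+ 2 + z.2 ^+ 2).

(* What [h =O_F q] means in landau.v (see eqO_exP there).  The notation itself is
   not available at +oo, whose filter has no canonical [filter_on] structure. *)
Definition bigO_near (R : realType) (T : Type) (F : set_system T)
    (h q : T -> R) : Prop :=
  exists2 C : R, 0 < C & \forall x \near F, `|h x| <= C * `|q x|.

(* (X, Y) solves the system on [T, +oo[.  The curves are total functions, of
   which only the values on [T, +oo[ matter.  Asking for a two-sided
   derivative at T costs no generality: a curve on [T, +oo[ with a right
   derivative at T extends to the left of T by its tangent line at T. *)
Definition solves_on_from (R : realType) (kappa mu : R)
    (f1 f2 g1 g2 : R * R -> R) (T : R) (X Y : R -> R) : Prop :=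
  forall t : R, T <= t ->
    is_derive t 1 X
      (- kappa * X t + f1 (X t, Y t) + expR (- t) * g1 (X t, Y t)) /\
    is_derive t 1 Y
      (mu * Y t + f2 (X t, Y t) + expR (- t) * g2 (X t, Y t)).

(* Main.v *)
Require Import Defs.
From HB Require Import structures.
From mathcomp Require Import all_boot all_order all_algebra.
From mathcomp Require Import all_classical all_reals all_analysis.
From mathcomp Require Import ring lra.

Set Implicit Arguments.
Unset Strict Implicit.
Unset Printing Implicit Defensive.

Import Order.TTheory GRing.Theory Num.Theory.
Import numFieldNormedType.Exports.
Local Open Scope classical_set_scope.
Local Open Scope ring_scope.

(** Near the origin the system is a saddle, contracting along X at rate kappa
and expanding along Y at rate mu, and the perturbing terms are at most eta * X
on the wedge - M2 * X <= Y <= M1 * X, with eta as small as desired once X is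
small and t is large (perturbation_le).  Choosing eta below delta, mu * M1 and
mu * M2 has two effects.  In the wedge X decreases, and at rate at least
kappa - delta, so that a solution staying there tends to 0 with the announced
speed.  On the two edges of the wedge the vector field points outwards, since X
decreases while Y is pushed away from 0.  Hence a trajectory that has left the
wedge through an edge never returns, and one that starts on an edge is already
lost on that side.  By the intermediate value theorem some initial height in
between gives a trajectory that has not left the wedge at a prescribed later
time, which is the shooting argument of Wazewski.

The functions are only continuous, so solutions need not be unique and the flow
need not exist.  The shooting is therefore done on Euler schemes, which do
depend continuously on their starting point (wedge_euler_orbit).  To let the
step tend to 0, the orbits are taken along an ultrafilter of steps: in the
compact wedge they converge pointwise, and the limit is a solution because the
increments of an Euler orbit over a short interval are close to the length of
the interval times the field (euler_increment, euler_limit_solution).  The same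
limit lets the time up to which the orbits stay in the wedge go to infinity. *)

(** * Limits of Euler schemes *)

Lemma fmap_ultrafilter (S U : Type) (f : S -> U) (F : set_system S) :
  UltraFilter F -> UltraFilter (fmap f F).
Proof.
move=> UF; split=> [|G GP FG]; first exact: fmap_proper_filter.
apply/seteqP; split=> // A GA.
case: (in_ultra_setVsetC (f @^-1` A) UF) => // FnA.
have GnA : G (~` A) by apply: FG.
have : G set0 by rewrite -(setICr A); exact: filterI.
by move/(@filter_not_empty _ _ GP).
Qed.

(** The recursion is imposed for N steps only, because the orbits obtained by
shooting stay in the wedge up to a prescribed time. *)
Definition euler_orbit (R : realType) (E : normedModType R) (V : R * E -> E)
    (T h : R) (N : nat) (z : nat -> E) : Prop :=
  forall k, (k < N)%N -> z k.+1 = z k + h *: V (T + k%:R * h, z k).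

(** Discrete mean value inequality.  With v = 0 it says that orbits are
Lipschitz in time, and with v a value of the field that they have approximately
the slope v. *)
Lemma euler_increment (R : realType) (E : normedModType R) (V : R * E -> E)
    (T h e : R) (N : nat) (z : nat -> E) (v : E) (i j : nat) :
  0 <= h -> euler_orbit V T h N z -> (i <= j)%N -> (j <= N)%N ->
  (forall k, (i <= k)%N -> (k < j)%N ->
     `|V (T + k%:R * h, z k) - v| <= e) ->
  `|z j - z i - ((j%:R - i%:R) * h) *: v| <= (j%:R - i%:R) * h * e.
Proof.
move=> h0 orb; elim: j => [|j IH] ij jN Vv.
  by move: ij; rewrite leqn0 => /eqP ->; rewrite !subrr !mul0r scale0r subr0 normr0.
move: ij; rewrite leq_eqVlt => /orP[/eqP <-|].
  by rewrite !subrr !mul0r scale0r subr0 normr0.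
rewrite ltnS => ij.
have := IH ij (ltnW jN) (fun k ik kj => Vv k ik (ltnW kj)).
have := Vv j ij (ltnSn _).
set w := V _ => wv IHj.
have -> : z j.+1 - z i - ((j.+1%:R - i%:R) * h) *: v =
    (z j - z i - ((j%:R - i%:R) * h) *: v) + h *: (w - v).
  rewrite orb // -/w -natr1 scalerBr.
  have -> : (j%:R + 1 - i%:R) * h = (j%:R - i%:R) * h + h by ring.
  by rewrite scalerDl opprD [_ + _ - z i]addrAC addrACA.
have -> : (j.+1%:R - i%:R) * h * e = (j%:R - i%:R) * h * e + h * e.
  by rewrite -natr1; ring.
apply: (le_trans (ler_normD _ _)); apply: lerD => //.
by rewrite normrZ ger0_norm // ler_wpM2l.
Qed.

(** A derivative can be checked on the increments of the function, which behave
well under pointwise limits, rather than on its difference quotients. *)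
Lemma is_derive_slope (R : realType) (E : normedModType R) (Z : R -> E)
    (t : R) (v : E) :
  (forall e : R, 0 < e -> exists2 r : R, 0 < r & forall s, `|s - t| < r ->
     `|Z s - Z t - (s - t) *: v| <= e * `|s - t|) ->
  is_derive t 1 Z v.
Proof.
move=> slope.
have lim_v : h^-1 *: (Z (h *: (1 : R) + t) - Z t) @[h --> (0:R)^'] --> v.
  apply/cvgrPdist_le => e /slope[r r0 Zr].
  near=> h.
  have h0 : h != 0 by near: h; exact: nbhs_dnbhs_neq.
  have hr : `|h| < r by near: h; exact: dnbhs0_lt.
  have := Zr (h + t); rewrite addrK => /(_ hr) Zh.
  have -> : v - h^-1 *: (Z (h *: (1 : R) + t) - Z t) =
     - (h^-1 *: (Z (h + t) - Z t - h *: v)).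
    have -> : h *: (1 : R) = h by rewrite /GRing.scale /= mulr1.
    by rewrite !scalerBr scalerA mulVf // scale1r [RHS]opprB.
  rewrite normrN normrZ normfV mulrC ler_pdivrMr // normr_gt0 //.
have ? : derivable Z t 1 by apply/cvg_ex; exists v.
by apply: DeriveDef => //; apply/cvg_lim.
Unshelve. all: by end_near. Qed.

Lemma truncn_step (R : realType) (h a : R) : 0 < h -> 0 <= a ->
  (Num.truncn (a / h))%:R * h <= a < (Num.truncn (a / h))%:R * h + h.
Proof.
move=> h0 a0; have /truncn_itv /andP[] : 0 <= a / h by rewrite divr_ge0 // ltW.
rewrite ler_pdivlMr // => -> /=; rewrite ltr_pdivrMr // -natr1 mulrDl mul1r.
by [].
Qed.

(** Peano's theorem with a viability constraint.  Along an ultrafilter of steps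
tending to 0 the orbits converge at every time, since they stay in the compact
set K.  The bound L on the field makes them nearly Lipschitz, uniformly in the
step, so that on a short interval around t they remain close to the limit at t;
there the field is nearly constant by continuity, and so is the slope of the
orbits, an inequality on increments that passes to the limit.  Keeping A apart from K records
a constraint on the initial point. *)
Lemma euler_limit_solution (R : realType) (E : normedModType R)
    (V : R * E -> E) (K A : set E) (T L h0 : R) :
  compact K -> closed A -> 0 < h0 ->
  (forall t z, T <= t -> K z -> {for (t, z), continuous V}) ->
  (forall t z, T <= t -> K z -> `|V (t, z)| <= L) ->
  (forall (h : R) N, 0 < h < h0 -> exists z : nat -> E,
     [/\ A (z 0%N), forall k, (k <= N)%N -> K (z k) & euler_orbit V T h N z]) ->
  exists Z : R -> E,
    [/\ A (Z T), forall t, T <= t -> K (Z t) &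
        forall t, T <= t -> is_derive t 1 Z (V (t, Z t))].
Proof.
move=> cptK clA h00 Vcont VL orbits.
(* After (h * h)^-1 steps of length h the time h^-1 has elapsed, so every
   bounded time interval is covered as h tends to 0. *)
pose N (h : R) := Num.truncn ((h * h)^-1).
have /choice[z zP] : forall h : R, exists z : nat -> E, 0 < h < h0 ->
    [/\ A (z 0%N), forall k, (k <= N h)%N -> K (z k) &
        euler_orbit V T h (N h) z].
  move=> h; case: (boolP (0 < h < h0)) => [hh|_]; last by exists (fun=> 0).
  by have [z] := orbits h (N h) hh; exists z.
have [U [UU ltU]] := ultraFilterLemma (at_right_proper_filter (0 : R)).
have UP : ProperFilter U by exact: ultra_proper.
pose idx (h t : R) := Num.truncn ((t - T) / h).
have U_step : \forall h \near U, 0 < h < h0.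
  apply: ltU; near=> h; apply/andP; split; near: h; first exact: nbhs_right_gt.
  exact: nbhs_right_lt.
have U_lt (d : R) : 0 < d -> \forall h \near U, h < d.
  by move=> d0; apply: ltU; exact: nbhs_right_lt.
have U_idx t : T <= t -> \forall h \near U, (idx h t <= N h)%N.
  move=> Tt; have d0 : 0 < (t - T + 1)^-1 by rewrite invr_gt0; lra.
  near=> h.
  have /andP[hp _] : 0 < h < h0 by near: h.
  have : h < (t - T + 1)^-1 by near: h; exact: U_lt.
  rewrite -[_ ^-1]div1r ltr_pdivlMr; last lra.
  move=> hlt; apply: le_truncn.
  rewrite ler_pdivrMr // invfM -mulrA mulVf ?gt_eqF // mulr1 -div1r ler_pdivlMr //.
  nra.
have /choice[Z ZP] : forall t : R, exists l, T <= t ->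
    K l /\ z h (idx h t) @[h --> U] --> l.
  move=> t; case: (lerP T t) => [Tt|_]; last by exists 0.
  have UZ := fmap_ultrafilter (fun h => z h (idx h t)) UU.
  have := cptK; rewrite compact_ultra => /(_ _ UZ).
  case=> [|l [Kl zl]]; last by exists l.
  rewrite /fmap /=; near=> h.
  have hh : 0 < h < h0 by near: h.
  have [_ + _] := zP _ hh; apply; near: h; exact: U_idx.
have KZ t : T <= t -> K (Z t) by move=> /ZP[].
have L0 : 0 <= L by rewrite (le_trans _ (VL _ _ (lexx T) (KZ T (lexx T)))).
have slope t (e : R) : T <= t -> 0 < e -> exists2 r : R, 0 < r &
    forall a b, T <= a -> a <= t -> t <= b -> b - a < r ->
      `|Z b - Z a - (b - a) *: V (t, Z t)| <= (b - a) * e.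
  move=> Tt e0; set v := V _.
  have [r r0 Vr] : exists2 r : R, 0 < r & forall s w, `|s - t| < r ->
      `|w - Z t| < r -> `|V (s, w) - v| <= e.
    have /cvgrPdist_le/(_ e e0) := Vcont t (Z t) Tt (KZ t Tt).
    move/nbhs_ballP => -[r /= r0 Vr]; exists r => // s w st wt.
    rewrite distrC; apply: Vr; split; rewrite -ball_normE /= distrC //.
  have L1 : 0 < 4 * (L + 1) by lra.
  (* An interval of length d, enlarged by a step h < d, has length at most
     2 * d; the orbit moves there by at most 2 * d * L <= r / 2. *)
  exists (r / (4 * (L + 1))); first exact: divr_gt0.
  set d := r / _.
  have dE : d * (4 * (L + 1)) = r by rewrite /d divfK // gt_eqF.
  have d0 : 0 < d by exact: divr_gt0.
  move=> a b Ta at_ tb abd.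
  have Tb : T <= b by lra.
  apply/ler_addgt0Pr => c c0.
  have cvab : `|z h (idx h b) - z h (idx h a) - (b - a) *: v| @[h --> U] -->
      `|Z b - Z a - (b - a) *: v|.
    apply: cvg_norm; apply: cvgB; last exact: cvg_cst.
    by apply: cvgB; [case: (ZP b Tb)|case: (ZP a Ta)].
  apply: (cvgr_to_le cvab).
  have c'0 : 0 < c / (e + `|v|) by rewrite divr_gt0 // ltr_wpDr.
  near=> h.
  have hh : 0 < h < h0 by near: h.
  have hd : h < d by near: h; exact: U_lt.
  have hc : h < c / (e + `|v|) by near: h; exact: U_lt.
  have jN : (idx h b <= N h)%N by near: h; exact: U_idx.
  have zt : `|Z t - z h (idx h t)| < r / 2.
    near: h; apply: cvgr_dist_lt; first by case: (ZP t Tt).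
    by rewrite divr_gt0.
  have [_ Kz orb] := zP _ hh.
  case/andP: hh => hp _.
  move: hc; rewrite ltr_pdivlMr ?ltr_wpDr // => hc.
  have /andP[ia1 ia2] : (idx h a)%:R * h <= a - T < (idx h a)%:R * h + h.
    by apply: truncn_step => //; lra.
  have /andP[jb1 jb2] : (idx h b)%:R * h <= b - T < (idx h b)%:R * h + h.
    by apply: truncn_step => //; lra.
  have im : (idx h a <= idx h t)%N.
    by apply: le_truncn; apply: ler_wpM2r; [rewrite invr_ge0 ltW|lra].
  have mj : (idx h t <= idx h b)%N.
    by apply: le_truncn; apply: ler_wpM2r; [rewrite invr_ge0 ltW|lra].
  move: im mj jN ia1 ia2 jb1 jb2 zt.
  set i := idx h a; set m := idx h t; set j := idx h b.
  move=> im mj jN ia1 ia2 jb1 jb2 zt.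
  have Lip k l : (i <= k)%N -> (k <= l)%N -> (l <= j)%N ->
      `|z h l - z h k| <= 2 * d * L.
    move=> ik kl lj.
    have := @euler_increment R E V T h L (N h) (z h) 0 k l (ltW hp) orb kl.
    rewrite scaler0 subr0 => /(_ (leq_trans lj jN)) incr.
    apply: (le_trans (incr _)) => [n kn nl|].
      rewrite subr0; apply: VL.
        by rewrite lerDl mulr_ge0 // ltW.
      by apply: Kz; rewrite (leq_trans (ltnW nl)) // (leq_trans lj).
    rewrite ler_wpM2r //.
    have : l%:R * h <= j%:R * h by apply: ler_wpM2r; [exact: ltW|rewrite ler_nat].
    have : i%:R * h <= k%:R * h by apply: ler_wpM2r; [exact: ltW|rewrite ler_nat].
    lra.
  have Vclose k : (i <= k)%N -> (k < j)%N -> `|V (T + k%:R * h, z h k) - v| <= e.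
    move=> ik kj.
    have kjh : k%:R * h <= j%:R * h.
      by apply: ler_wpM2r; [exact: ltW|rewrite ler_nat ltnW].
    have ikh : i%:R * h <= k%:R * h.
      by apply: ler_wpM2r; [exact: ltW|rewrite ler_nat].
    apply: Vr.
      have : 0 <= d * L by rewrite mulr_ge0 // ltW.
      move=> dL; rewrite ltr_norml; apply/andP; split; lra.
    have zkm : `|z h k - z h m| <= 2 * d * L.
      case: (leqP k m) => km; last by apply: Lip => //; exact: ltnW.
      by rewrite distrC; apply: Lip.
    have := ler_distD (z h m) (z h k) (Z t).
    rewrite [`|z h m - _|]distrC; lra.
  have := euler_increment (ltW hp) orb (leq_trans im mj) jN Vclose.
  set q := (j%:R - i%:R) * h => zq.
  have qE : `|q - (b - a)| <= h.
    rewrite /q mulrBl ler_norml; apply/andP; split; lra.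
  have -> : z h j - z h i - (b - a) *: v =
      (z h j - z h i - q *: v) + (q - (b - a)) *: v.
    by rewrite [(q - _) *: v]scalerBl addrA subrK.
  apply: (le_trans (ler_normD _ _)); rewrite normrZ.
  have qv : `|q - (b - a)| * `|v| <= h * `|v| by rewrite ler_wpM2r.
  have qe : q * e <= (b - a + h) * e.
    apply: ler_wpM2r; first exact: ltW.
    move: qE; rewrite ler_norml; lra.
  rewrite mulrDr in hc; rewrite mulrDl in qe; lra.
(* The limit is extended by its tangent on the left of T, which makes the
   derivative at T two-sided. *)
pose v0 := V (T, Z T).
pose Y t := if t < T then Z T + (t - T) *: v0 else Z t.
have YE t : T <= t -> Y t = Z t by rewrite /Y ltNge => ->.
exists Y; split=> [|t Tt|t Tt].
- rewrite YE //; have [_ ZT] := ZP T (lexx T).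
  apply: (@closed_cvg _ _ U _ _ A clA _ _ ZT); near=> h.
  rewrite /idx subrr mul0r truncn0.
  have hh : 0 < h < h0 by near: h.
  by have [] := zP _ hh.
- by rewrite YE //; exact: KZ.
rewrite YE //; apply: is_derive_slope => e e0.
have [r r0 Zr] := slope t e Tt e0.
have right_slope s : t <= s -> `|s - t| < r ->
    `|Y s - Y t - (s - t) *: V (t, Z t)| <= e * `|s - t|.
  move=> ts; rewrite ger0_norm ?subr_ge0 // => str.
  by rewrite !YE // ?(le_trans Tt) // mulrC; exact: Zr.
have left_slope s : T <= s -> s <= t -> `|s - t| < r ->
    `|Y s - Y t - (s - t) *: V (t, Z t)| <= e * `|s - t|.
  move=> Ts st; rewrite distrC ger0_norm ?subr_ge0 // => str.
  rewrite !YE // mulrC -normrN.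
  rewrite [- (_ - _ *: _)]opprB -[Z s - Z t]opprB opprK addrC.
  by rewrite -[s - t]opprB scaleNr; exact: Zr.
move: Tt; rewrite le_eqVlt => /orP[/eqP Tt|Tt].
  subst t; exists r => // s sr; case: (boolP (T <= s)) => [|/negbTE sT].
    by move=> ?; exact: right_slope.
  rewrite /Y ltNge sT ltxx /= [_ + _ - Z T]addrAC subrr add0r /v0 subrr normr0.
  by rewrite mulr_ge0 // ltW.
exists (Num.min r (t - T)); first by rewrite lt_min r0 subr_gt0.
move=> s; rewrite lt_min => /andP[sr sT].
have [ts|st] := boolP (t <= s); first exact: right_slope.
apply: left_slope => //; first by move: sT; rewrite ltr_norml; lra.
by rewrite ltW // ltNge.
Unshelve. all: by end_near. Qed.

(** * Shooting in a wedge *)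

Definition wedge (R : realType) (M1 M2 eps : R) : set (R * R) :=
  [set z | [/\ 0 <= z.1, z.1 <= eps, - M2 * z.1 <= z.2 & z.2 <= M1 * z.1]].

(** The field is controlled in the wedge only.  Evaluating it at the vertically
projected point defines the scheme everywhere, keeps it continuous, and makes a
point beyond an edge move as if it were on that edge, hence stay beyond. *)
Definition clip (R : realType) (M1 M2 : R) (z : R * R) : R * R :=
  (z.1, Num.max (- M2 * z.1) (Num.min (M1 * z.1) z.2)).

Lemma continuous_pair (S U1 U2 : topologicalType) (f : S -> U1) (g : S -> U2)
    (x : S) : {for x, continuous f} -> {for x, continuous g} ->
  {for x, continuous (fun y => (f y, g y))}.
Proof. by move=> cf cg; exact: (cvg_pair (H := nbhs (g x)) cf cg). Qed.

Lemma continuous_clip (R : realType) (M1 M2 : R) : continuous (clip M1 M2).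
Proof.
move=> z.
have c1 : {for z, continuous (fun z : R * R => z.1)} by exact: cvg_fst.
have c2 : {for z, continuous (fun z : R * R => z.2)} by exact: cvg_snd.
apply: continuous_pair => //.
apply: (@continuous_max R _ (fun z : R * R => - M2 * z.1)
  (fun z : R * R => Num.min (M1 * z.1) z.2)).
  by apply: cvgM => //; exact: cvg_cst.
apply: (@continuous_min R _ (fun z : R * R => M1 * z.1)) => //.
by apply: cvgM => //; exact: cvg_cst.
Qed.

Lemma clip_wedge (R : realType) (M1 M2 eps : R) (z : R * R) :
  0 < M1 -> 0 < M2 -> 0 <= z.1 -> z.1 <= eps -> wedge M1 M2 eps (clip M1 M2 z).
Proof.
move=> M10 M20 z0 ze; split => //=; first by rewrite le_max lexx.
by rewrite ge_max ge_min lexx /= andbT; nra.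
Qed.

Lemma clip_id (R : realType) (M1 M2 : R) (z : R * R) :
  - M2 * z.1 <= z.2 -> z.2 <= M1 * z.1 -> clip M1 M2 z = z.
Proof. by move=> dn up; rewrite /clip min_r // max_r // -surjective_pairing. Qed.

Lemma clip_above (R : realType) (M1 M2 : R) (z : R * R) :
  0 < M1 -> 0 < M2 -> 0 <= z.1 -> M1 * z.1 <= z.2 ->
  clip M1 M2 z = (z.1, M1 * z.1).
Proof. by move=> M10 M20 z0 up; rewrite /clip min_l // max_r //; nra. Qed.

Lemma clip_below (R : realType) (M1 M2 : R) (z : R * R) :
  z.2 <= - M2 * z.1 -> clip M1 M2 z = (z.1, - M2 * z.1).
Proof. by move=> dn; rewrite /clip max_l // ge_min dn orbT. Qed.

Lemma compact_wedge (R : realType) (M1 M2 eps : R) :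
  0 < M1 -> 0 < M2 -> compact (wedge M1 M2 eps).
Proof.
move=> M10 M20.
apply: (@subclosed_compact _ _
    (`[0, eps]%classic `*` `[- M2 * eps, M1 * eps]%classic)).
- have cl (f : R * R -> R) : continuous f -> closed [set z | 0 <= f z].
    by move=> cf; apply: (@preimage_closed _ _ f [set y | 0 <= y]) => //;
       exact: closed_ge.
  have -> : wedge M1 M2 eps = [set z | 0 <= z.1] `&` [set z | 0 <= eps - z.1]
     `&` ([set z | 0 <= z.2 - - M2 * z.1] `&` [set z | 0 <= M1 * z.1 - z.2]).
    apply/seteqP; split=> z /=; rewrite !subr_ge0; first by case.
    by case=> -[? ?] [? ?].
  have c1 : continuous (fun z : R * R => z.1) by move=> z; exact: cvg_fst.
  have c2 : continuous (fun z : R * R => z.2) by move=> z; exact: cvg_snd.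
  have cM (a : R) : continuous (fun z : R * R => a * z.1).
    by move=> z; apply: cvgM; [exact: cvg_cst|exact: c1].
  apply: closedI; apply: closedI; apply: cl => // z.
  + by apply: cvgB; [exact: cvg_cst|exact: c1].
  + by apply: cvgB; [exact: c2|exact: cM].
  + by apply: cvgB; [exact: cM|exact: c2].
- by apply: compact_setX; exact: segment_compact.
- move=> z [z0 ze dn up]; split=> /=; rewrite in_itv /=; apply/andP; split=> //.
    nra.
  nra.
Qed.

(** The first coordinate of the clipped scheme decreases and stays positive, as
one step of length h cannot remove more than the fraction h * B of it.  As the
field points outwards on the edges, the regions above and below the wedge are
absorbing.  An orbit whose second coordinate vanishes after N steps, which
exists by the intermediate value theorem, has thus been in the wedge all along,
and there clipping changes nothing. *)
Lemma wedge_euler_orbit (R : realType) (V : R * (R * R) -> R * R)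
    (M1 M2 eps T B h : R) (N : nat) :
  0 < M1 -> 0 < M2 -> 0 < eps -> 0 < h -> h * B < 1 ->
  (forall t z, T <= t -> wedge M1 M2 eps z -> {for (t, z), continuous V}) ->
  (forall t z, T <= t -> wedge M1 M2 eps z -> - B * z.1 <= (V (t, z)).1 <= 0) ->
  (forall t x, T <= t -> 0 <= x -> x <= eps -> 0 <= (V (t, (x, M1 * x))).2) ->
  (forall t x, T <= t -> 0 <= x -> x <= eps -> (V (t, (x, - M2 * x))).2 <= 0) ->
  exists z : nat -> R * R,
    [/\ (z 0%N).1 = eps, forall k, (k <= N)%N -> wedge M1 M2 eps (z k) &
        euler_orbit V T h N z].
Proof.
move=> M10 M20 e0 h0 hB Vcont Vx Vup Vdn.
pose orb := fix orb (s : R) (k : nat) : R * R :=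
  if k is k'.+1 then
    orb s k' + h *: V (T + k'%:R * h, clip M1 M2 (orb s k'))
  else (eps, s).
have Tk k : T <= T + k%:R * h by rewrite lerDl mulr_ge0 // ltW.
have orbx s k : 0 < (orb s k).1 <= eps.
  elim: k => [|k /andP[x0 xe]] /=; first by rewrite e0 lexx.
  have := Vx _ _ (Tk k) (clip_wedge M10 M20 (ltW x0) xe).
  rewrite {1}/clip /=; set x := (orb s k).1 in x0 xe *; set v := (V _).1.
  rewrite /GRing.scale /= => /andP[v1 v2]; apply/andP; split; nra.
have orbxS s k : (orb s k.+1).1 <= (orb s k).1.
  have /andP[x0 xe] := orbx s k.
  have /andP[_] := Vx _ _ (Tk k) (clip_wedge M10 M20 (ltW x0) xe).
  rewrite /= /GRing.scale /=; set v := (V _).1 => v2; nra.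
have above s k n : M1 * (orb s k).1 <= (orb s k).2 ->
    M1 * (orb s (n + k)%N).1 <= (orb s (n + k)%N).2.
  move=> ab; elim: n => [//|n IH]; rewrite addSn.
  set m := (n + k)%N in IH *; have /andP[x0 xe] := orbx s m.
  have xS : M1 * (orb s m.+1).1 <= M1 * (orb s m).1 by rewrite ler_pM2l.
  apply: (le_trans xS); apply: (le_trans IH).
  rewrite /= clip_above //; last exact: ltW.
  by rewrite lerDl mulr_ge0 ?Vup // ltW.
have below s k n : (orb s k).2 <= - M2 * (orb s k).1 ->
    (orb s (n + k)%N).2 <= - M2 * (orb s (n + k)%N).1.
  move=> be; elim: n => [//|n IH]; rewrite addSn.
  set m := (n + k)%N in IH *; have /andP[x0 xe] := orbx s m.
  have xS : - M2 * (orb s m).1 <= - M2 * (orb s m.+1).1.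
    by rewrite !mulNr lerN2 ler_pM2l.
  apply: (le_trans _ xS); apply: (le_trans _ IH).
  rewrite /= clip_below // gerDl mulr_ge0_le0 ?Vdn //; exact: ltW.
have orb_cont k : continuous (orb ^~ k).
  elim: k => [|k IH] s /=.
    by apply: continuous_pair; [exact: cvg_cst|exact: cvg_id].
  apply: cvgD; first exact: IH.
  apply: cvgZr.
  have /andP[x0 xe] := orbx s k.
  have clipc : {for s, continuous (fun u => clip M1 M2 (orb u k))}.
    by apply: continuous_comp; [exact: IH|exact: continuous_clip].
  have Tc : {for s, continuous (fun=> T + k%:R * h)} by exact: cvg_cst.
  apply: (continuous_comp (continuous_pair Tc clipc)).
  by apply: Vcont => //; apply: clip_wedge => //; exact: ltW.
have [s _ sN] : exists2 s, s \in `[- M2 * eps, M1 * eps] & (orb s N).2 = 0.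
  apply: (@IVT R (fun s => (orb s N).2)); first by nra.
    apply: continuous_subspaceT => s.
    by apply: (@cvg_comp _ _ _ (orb ^~ N)); [exact: orb_cont|exact: cvg_snd].
  have up := above (M1 * eps) 0%N N (lexx _).
  have dn := below (- M2 * eps) 0%N N (lexx _).
  rewrite addn0 in up dn.
  have /andP[u0 _] := orbx (M1 * eps) N.
  have /andP[d0 _] := orbx (- M2 * eps) N.
  apply/andP; split.
    rewrite ge_min; apply/orP; left; nra.
  rewrite le_max; apply/orP; right; nra.
have in_wedge k : (k <= N)%N -> wedge M1 M2 eps (orb s k).
  move=> kN; have /andP[x0 xe] := orbx s k; have /andP[xN _] := orbx s N.
  split=> //; first exact: ltW.
    rewrite leNgt; apply/negP => /ltW /(below s k (N - k)%N).
    by rewrite subnK // sN; nra.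
  rewrite leNgt; apply/negP => /ltW /(above s k (N - k)%N).
  by rewrite subnK // sN; nra.
exists (orb s); split=> // k kN /=.
by have [_ _ dn up] := in_wedge k (ltnW kN); rewrite clip_id.
Qed.

(** Continuous-time version of the shooting, which determines only the first
coordinate of the initial point. *)
Lemma wedge_solution (R : realType) (V : R * (R * R) -> R * R)
    (M1 M2 eps T B L : R) :
  0 < M1 -> 0 < M2 -> 0 < eps -> 0 < B ->
  (forall t z, T <= t -> wedge M1 M2 eps z -> {for (t, z), continuous V}) ->
  (forall t z, T <= t -> wedge M1 M2 eps z -> `|V (t, z)| <= L) ->
  (forall t z, T <= t -> wedge M1 M2 eps z -> - B * z.1 <= (V (t, z)).1 <= 0) ->
  (forall t x, T <= t -> 0 <= x -> x <= eps -> 0 <= (V (t, (x, M1 * x))).2) ->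
  (forall t x, T <= t -> 0 <= x -> x <= eps -> (V (t, (x, - M2 * x))).2 <= 0) ->
  exists Z : R -> R * R,
    [/\ (Z T).1 = eps, forall t, T <= t -> wedge M1 M2 eps (Z t) &
        forall t, T <= t -> is_derive t 1 Z (V (t, Z t))].
Proof.
move=> M10 M20 e0 B0 Vcont VL Vx Vup Vdn.
have clA : closed [set z : R * R | z.1 = eps].
  apply: (@preimage_closed _ _ fst [set y | y = eps]); last exact: closed_eq.
  by move=> z _; exact: cvg_fst.
apply: (euler_limit_solution (compact_wedge M10 M20) clA
  (h0 := B^-1) _ Vcont VL); first by rewrite invr_gt0.
move=> h N /andP[h0]; rewrite -[_^-1]div1r ltr_pdivlMr // => hB.
exact: (wedge_euler_orbit N M10 M20 e0 h0 hB Vcont Vx Vup Vdn).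
Qed.

(** * Derivatives of components and exponential decay *)

Lemma is_derive_fst (R : realType) (U W : normedModType R) (Z : R -> U * W)
    (t : R) (v : U * W) :
  is_derive t 1 Z v -> is_derive t 1 (fun s => (Z s).1) v.1.
Proof.
move=> [dZ vE].
have lim_v : (h^-1 *: (Z (h *: (1 : R) + t) - Z t)).1 @[h --> (0:R)^'] --> v.1.
  have lim_Z : h^-1 *: (Z (h *: (1 : R) + t) - Z t) @[h --> (0:R)^'] --> v.
    by rewrite -vE; exact: dZ.
  have cv : {for v, continuous (@fst U W)} by exact: cvg_fst.
  exact: (continuous_cvg _ cv lim_Z).
by split; [apply/cvg_ex; exists v.1|apply/cvg_lim].
Qed.

Lemma is_derive_snd (R : realType) (U W : normedModType R) (Z : R -> U * W)
    (t : R) (v : U * W) :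
  is_derive t 1 Z v -> is_derive t 1 (fun s => (Z s).2) v.2.
Proof.
move=> [dZ vE].
have lim_v : (h^-1 *: (Z (h *: (1 : R) + t) - Z t)).2 @[h --> (0:R)^'] --> v.2.
  have lim_Z : h^-1 *: (Z (h *: (1 : R) + t) - Z t) @[h --> (0:R)^'] --> v.
    by rewrite -vE; exact: dZ.
  have cv : {for v, continuous (@snd U W)} by exact: cvg_snd.
  exact: (continuous_cvg _ cv lim_Z).
by split; [apply/cvg_ex; exists v.2|apply/cvg_lim].
Qed.

(** The product of X t and expR (c * t) is nonincreasing. *)
Lemma exp_decay (R : realType) (X dX : R -> R) (c T : R) :
  (forall t, T <= t -> is_derive t 1 X (dX t)) ->
  (forall t, T <= t -> dX t <= - c * X t) ->
  forall t, T <= t -> X t <= X T * expR (- c * (t - T)).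
Proof.
move=> derX dXle t Tt.
pose W s := X s * expR (c * s).
have derW s : T <= s -> is_derive s 1 W ((dX s + c * X s) * expR (c * s)).
  move=> Ts; have dXs := derX s Ts.
  rewrite /W; apply: is_derive_eq.
  rewrite /GRing.scale /=; ring.
have : W t <= W T.
  apply: (@ler0_derive1_le_cc R W T t) => //.
  - by move=> s; rewrite in_itv /= => /andP[Ts _]; have [] := derW s (ltW Ts).
  - move=> s; rewrite in_itv /= => /andP[Ts _]; rewrite derive1E.
    have [_ ->] := derW s (ltW Ts).
    rewrite mulr_le0_ge0 ?expR_ge0 //; have := dXle s (ltW Ts); lra.
  - apply: derivable_within_continuous => s; rewrite in_itv /= => /andP[Ts _].
    by have [] := derW s Ts.
  - by rewrite in_itv /= lexx ?andbT.
  - by rewrite in_itv /= lexx ?andbT.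
rewrite /W -ler_pdivlMr ?expR_gt0 // -expRN -mulrA -expRD.
by have -> : c * T - c * t = - c * (t - T) by ring.
Qed.

Lemma bigO_exp_cvg0 (R : realType) (X : R -> R) (c : R) : 0 < c ->
  bigO_near +oo X (fun t => expR (- c * t)) -> X t @[t --> +oo] --> (0 : R).
Proof.
move=> c0 [C C0 XC].
apply/cvgr0Pnorm_le => e e0; near=> t.
have /le_trans : `|X t| <= C * `|expR (- c * t)| by near: t; exact: XC.
apply; rewrite ger0_norm ?expR_ge0 //.
have t1 : C / (e * c) <= t by near: t; apply: nbhs_pinfty_ge; exact: num_real.
rewrite mulNr expRN ler_pdivrMr ?expR_gt0 //.
have := expR_ge1Dx (c * t).
move: t1; rewrite ler_pdivrMr ?mulr_gt0 // => t1 t2.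
have : e * (1 + c * t) <= e * expR (c * t) by rewrite ler_pM2l.
nra.
Unshelve. all: by end_near. Qed.

(** * Size of the perturbing terms *)

Lemma enorm_le (R : realType) (z : R * R) : enorm z <= `|z.1| + `|z.2|.
Proof.
rewrite /enorm -(ger0_norm (addr_ge0 (normr_ge0 z.1) (normr_ge0 z.2))) -sqrtr_sqr.
rewrite ler_wsqrtr // sqrrD !real_normK ?num_real //.
have : 0 <= `|z.1| * `|z.2| by rewrite mulr_ge0.
lra.
Qed.

(** The bound forces h 0 = 0 by continuity, as is seen by letting z tend to 0
along the first axis, and therefore extends to the origin. *)
Lemma bigO_near0 (R : realType) (h : R * R -> R) (C : R) : 0 <= C ->
  {for (0 : R * R), continuous h} ->
  (\forall z \near (0 : R * R)^', `|h z| <= C * `|enorm z|) ->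
  \forall z \near (0 : R * R), `|h z| <= C * enorm z.
Proof.
move=> C0 ch hC.
have h0 : h 0 = 0.
  apply/normr0_eq0/eqP; rewrite eq_le normr_ge0 andbT; apply/ler_addgt0Pr => e e0.
  rewrite add0r.
  have e2 : 0 < e / 2 by rewrite divr_gt0.
  have /cvgrPdist_le/(_ _ e2) hz := ch.
  have /nbhs_ballP[r /= r0 rP] : nbhs (0 : R * R) (fun z => `|h 0 - h z| <= e / 2 /\
      (z != 0 -> `|h z| <= C * `|enorm z|)) by apply: filterI.
  pose x := Num.min (r / 2) (e / 2 / (C + 1)).
  have C1 : 0 < C + 1 by lra.
  have x0 : 0 < x by rewrite lt_min !divr_gt0.
  have xr : x <= r / 2 by rewrite /x ge_min lexx.
  have xe : x * (C + 1) <= e / 2 by rewrite -ler_pdivlMr // /x ge_min lexx orbT.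
  have [|hx1] := rP (x, 0).
    split; rewrite -ball_normE /= sub0r normrN ?normr0 // gtr0_norm //; lra.
  have enx : `|enorm (x, 0)| = x.
    by rewrite /enorm /= expr0n /= addr0 sqrtr_sqr normr_id gtr0_norm.
  rewrite enx; have -> : (x, 0) != 0 :> R * R.
    by apply/eqP => -[/eqP]; rewrite gt_eqF.
  move=> /(_ isT) hx2; have := ler_distD (h (x, 0)) (h 0) 0.
  rewrite !subr0; nra.
have : \forall z \near (0 : R * R), z != 0 -> `|h z| <= C * `|enorm z| by [].
apply: filterS => z; case: (eqVneq z 0) => [-> _|_ /(_ isT)].
  by rewrite h0 normr0 mulr_ge0 // sqrtr_ge0.
by rewrite [`|enorm z|]ger0_norm // sqrtr_ge0.
Qed.

Lemma wedge_near0 (R : realType) (M1 M2 : R) (P : set (R * R)) :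
  0 < M1 -> 0 < M2 -> nbhs (0 : R * R) P ->
  exists2 eps0 : R, 0 < eps0 &
    forall eps, eps <= eps0 -> wedge M1 M2 eps `<=` P.
Proof.
move=> M10 M20 /nbhs_ballP[r /= r0 rP].
have S0 : 0 < 1 + M1 + M2 by lra.
exists (r / (1 + M1 + M2) / 2); first by rewrite !divr_gt0.
move=> eps; rewrite ler_pdivlMr // ler_pdivlMr // => er z [z0 ze dn up].
apply: rP; split; rewrite -ball_normE /= sub0r normrN ltr_norml;
  apply/andP; split; nra.
Qed.

Lemma small_near0 (R : realType) (f : R * R -> R) (c : R) : 0 < c ->
  {for (0 : R * R), continuous f} ->
  f z / enorm z @[z --> (0 : R * R)^'] --> (0 : R) ->
  \forall z \near (0 : R * R), `|f z| <= c * enorm z.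
Proof.
move=> c0 cf fE; apply: bigO_near0 => //; first exact: ltW.
have fE' : \forall z \near (0 : R * R)^', `|f z / enorm z| <= c.
  by apply: cvgr0_norm_le.
have z0 : \forall z \near (0 : R * R)^', z != 0 by exact: nbhs_dnbhs_neq.
apply: filterS2 fE' z0 => z fz z0.
have ez : 0 < enorm z.
  rewrite sqrtr_gt0 lt_neqAle addr_ge0 ?sqr_ge0 // andbT eq_sym.
  rewrite paddr_eq0 ?sqr_ge0 // !sqrf_eq0; apply: contra_neqN z0.
  by case/andP=> /eqP z1 /eqP z2; rewrite [z]surjective_pairing z1 z2.
by move: fz; rewrite normrM normfV ler_pdivrMr // normr_gt0 gt_eqF.
Qed.

(** In the wedge the norm of z is at most 1 + M1 + M2 times its first
coordinate, and the time T is late enough for the exponential factor to beat the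
constant C.  The two terms contribute equally, whence the factor 2. *)
Lemma perturbation_le (R : realType) (f g : R * R -> R) (M1 M2 eta C T : R)
    (z : R * R) (eps t : R) : 0 < M1 -> 0 < M2 ->
  0 <= C -> C * expR (- T) <= eta / (2 * (1 + M1 + M2)) -> T <= t ->
  `|f z| <= eta / (2 * (1 + M1 + M2)) * enorm z -> `|g z| <= C * enorm z ->
  wedge M1 M2 eps z ->
  `|f z + expR (- t) * g z| <= eta * z.1.
Proof.
move=> M10 M20 C0 CT Tt fz gz [z0 _ dn up].
have S0 : 0 < 2 * (1 + M1 + M2) by lra.
have en0 : 0 <= enorm z by exact: sqrtr_ge0.
have enz : enorm z <= (1 + M1 + M2) * z.1.
  apply: (le_trans (enorm_le z)); rewrite ger0_norm //.
  have : `|z.2| <= (M1 + M2) * z.1 by rewrite ler_norml; apply/andP; split; nra.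
  lra.
have egz : `|expR (- t) * g z| <= eta / (2 * (1 + M1 + M2)) * enorm z.
  rewrite normrM ger0_norm ?expR_ge0 //.
  have tT : expR (- t) <= expR (- T) by rewrite ler_expR lerN2.
  apply: (le_trans (ler_pM (expR_ge0 _) (normr_ge0 _) tT gz)).
  by rewrite mulrA [expR _ * C]mulrC; apply: ler_wpM2r.
apply: (le_trans (ler_normD _ _)); apply: (le_trans (lerD fz egz)).
set c := eta / _ in CT *; have cE : c * (2 * (1 + M1 + M2)) = eta.
  by rewrite /c divfK // gt_eqF.
have c0 : 0 <= c by rewrite (le_trans _ CT) // mulr_ge0 ?expR_ge0.
have : c * enorm z <= c * ((1 + M1 + M2) * z.1) by apply: ler_wpM2l.
rewrite -cE; lra.
Qed.

(** * The perturbed saddle *)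

Theorem theorem4p3 (R : realType) (kappa mu : R) (f1 f2 g1 g2 : R * R -> R)
    (mu_gt0 : 0 < mu) (kappa_lt0 : - kappa < 0)
    (f1_cont : \forall z \near (0 : R * R), {for z, continuous f1})
    (f2_cont : \forall z \near (0 : R * R), {for z, continuous f2})
    (g1_cont : \forall z \near (0 : R * R), {for z, continuous g1})
    (g2_cont : \forall z \near (0 : R * R), {for z, continuous g2})
    (f1_small : f1 z / enorm z @[z --> (0 : R * R)^'] --> (0 : R))
    (f2_small : f2 z / enorm z @[z --> (0 : R * R)^'] --> (0 : R))
    (g1_bigO : bigO_near (0 : R * R)^' g1 (@enorm R))
    (g2_bigO : bigO_near (0 : R * R)^' g2 (@enorm R)) :
  forall M1 M2 delta : R, 0 < M1 -> 0 < M2 -> 0 < delta -> delta < kappa ->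
  exists eps0 T0 : R, [/\ 0 < eps0, 0 < T0 &
    forall eps T : R, 0 < eps -> eps <= eps0 -> T0 <= T ->
    exists X Y : R -> R,
      [/\ solves_on_from kappa mu f1 f2 g1 g2 T X Y,
          X T = eps,
          (X t, Y t) @[t --> +oo] --> (0 : R * R),
          (forall t : R, T <= t ->
             [/\ 0 <= X t, X t <= eps, - M2 * X t <= Y t & Y t <= M1 * X t]) &
          bigO_near +oo X (fun t : R => expR (- (kappa - delta) * t)) /\
          bigO_near +oo Y (fun t : R => expR (- (kappa - delta) * t))]].
Proof.
move=> M1 M2 delta M10 M20 d0 dk.
have k0 : 0 < kappa by lra.
have at0 (h : R * R -> R) : (\forall z \near (0 : R * R), {for z, continuous h}) ->
    {for (0 : R * R), continuous h} by exact: nbhs_singleton.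
have [C1 C10 /(bigO_near0 (ltW C10) (at0 _ g1_cont)) g1C] := g1_bigO.
have [C2 C20 /(bigO_near0 (ltW C20) (at0 _ g2_cont)) g2C] := g2_bigO.
(* eta <= delta gives the rate of decay, the other two bounds make the field
   point outwards on the edges. *)
pose eta := Num.min delta (Num.min (mu * M1) (mu * M2)).
have eta0 : 0 < eta by rewrite !lt_min d0 !mulr_gt0.
have etad : eta <= delta by rewrite /eta ge_min lexx.
have eta1 : eta <= mu * M1 by rewrite /eta !ge_min lexx orbT.
have eta2 : eta <= mu * M2 by rewrite /eta !ge_min lexx !orbT.
pose c := eta / (2 * (1 + M1 + M2)).
have c0 : 0 < c by rewrite divr_gt0 //; lra.
(* T0 makes (C1 + C2) * expR (- T0) <= c because expR T0 > T0. *)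
pose T0 := (C1 + C2) / c.
have T00 : 0 < T0 by rewrite divr_gt0 //; lra.
have CT0 : (C1 + C2) * expR (- T0) <= c.
  rewrite expRN ler_pdivrMr ?expR_gt0 // mulrC -ler_pdivrMr // -/T0.
  by apply: (le_trans _ (expR_ge1Dx T0)); lra.
have [eps0 eps00 wP] : exists2 eps0 : R, 0 < eps0 & forall eps, eps <= eps0 ->
    wedge M1 M2 eps `<=` [set z |
    [/\ {for z, continuous f1}, {for z, continuous f2}, {for z, continuous g1}
      & {for z, continuous g2}] /\
    [/\ `|f1 z| <= c * enorm z, `|f2 z| <= c * enorm z,
      `|g1 z| <= C1 * enorm z & `|g2 z| <= C2 * enorm z]].
  apply: wedge_near0 => //.
  have s1 := small_near0 c0 (at0 _ f1_cont) f1_small.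
  have s2 := small_near0 c0 (at0 _ f2_cont) f2_small.
  by near=> z; split; split; near: z.
exists eps0, T0; split=> // eps T e0 ee0 TT0.
pose V (q : R * (R * R)) : R * R :=
  (- kappa * q.2.1 + f1 q.2 + expR (- q.1) * g1 q.2,
   mu * q.2.2 + f2 q.2 + expR (- q.1) * g2 q.2).
have Vcont t z : T <= t -> wedge M1 M2 eps z -> {for (t, z), continuous V}.
  move=> Tt /(wP _ ee0)[[cf1 cf2 cg1 cg2] _].
  have q1 : {for (t, z), continuous (fun q : R * (R * R) => q.1)} by exact: cvg_fst.
  have q2 : {for (t, z), continuous (fun q : R * (R * R) => q.2)} by exact: cvg_snd.
  have q21 : {for (t, z), continuous (fun q : R * (R * R) => q.2.1)}.
    by apply: (continuous_comp q2); exact: cvg_fst.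
  have q22 : {for (t, z), continuous (fun q : R * (R * R) => q.2.2)}.
    by apply: (continuous_comp q2); exact: cvg_snd.
  have qe : {for (t, z), continuous (fun q : R * (R * R) => expR (- q.1))}.
    apply: (@continuous_comp _ _ _ (fun q : R * (R * R) => - q.1)).
      by apply: cvgN.
    exact: continuous_expR.
  have on2 (h : R * R -> R) : {for z, continuous h} ->
      {for (t, z), continuous (fun q : R * (R * R) => h q.2)}.
    by move=> ch; apply: (continuous_comp q2).
  apply: continuous_pair; apply: cvgD.
  - by apply: cvgD; [apply: cvgM => //; exact: cvg_cst|exact: on2].
  - by apply: cvgM => //; exact: on2.
  - by apply: cvgD; [apply: cvgM => //; exact: cvg_cst|exact: on2].
  - by apply: cvgM => //; exact: on2.
have Vb t z : T <= t -> wedge M1 M2 eps z ->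
    `|(V (t, z)).1 + kappa * z.1| <= eta * z.1 /\
    `|(V (t, z)).2 - mu * z.2| <= eta * z.1.
  move=> Tt zw; have [_ [b1 b2 b3 b4]] := wP _ ee0 _ zw.
  have en0 : 0 <= enorm z by exact: sqrtr_ge0.
  have TT : T0 <= t by lra.
  have C0 : 0 <= C1 + C2 by lra.
  split=> /=.
  - have -> : - kappa * z.1 + f1 z + expR (- t) * g1 z + kappa * z.1 =
       f1 z + expR (- t) * g1 z by ring.
    by apply: (perturbation_le M10 M20 C0 CT0 TT b1 _ zw); nra.
  - have -> : mu * z.2 + f2 z + expR (- t) * g2 z - mu * z.2 =
       f2 z + expR (- t) * g2 z by ring.
    by apply: (perturbation_le M10 M20 C0 CT0 TT b2 _ zw); nra.
have [Z [ZT Zw dZ]] : exists Z : R -> R * R,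
    [/\ (Z T).1 = eps, forall t, T <= t -> wedge M1 M2 eps (Z t) &
        forall t, T <= t -> is_derive t 1 Z (V (t, Z t))].
  apply: (@wedge_solution R V M1 M2 eps T (kappa + eta)
     ((kappa + mu * (M1 + M2) + eta) * eps)) => //; first by lra.
  - move=> t z Tt zw; have [] := Vb t z Tt zw; have [z0 ze dn up] := zw.
    set v := V _; rewrite !ler_norml => /andP[v1 v2] /andP[v3 v4].
    have kz : kappa * z.1 <= kappa * eps by rewrite ler_pM2l.
    have ez : eta * z.1 <= eta * eps by rewrite ler_pM2l.
    have kz0 : 0 <= kappa * z.1 by rewrite mulr_ge0 // ltW.
    have ez0 : 0 <= eta * z.1 by rewrite mulr_ge0 // ltW.
    have m1 : mu * z.2 <= mu * (M1 * z.1) by rewrite ler_pM2l.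
    have m2 : mu * (- M2 * z.1) <= mu * z.2 by rewrite ler_pM2l.
    have m3 : mu * M1 * z.1 <= mu * M1 * eps by rewrite ler_pM2l ?mulr_gt0.
    have m4 : mu * M2 * z.1 <= mu * M2 * eps by rewrite ler_pM2l ?mulr_gt0.
    have m5 : 0 <= mu * M1 * z.1 by rewrite !mulr_ge0 // ltW.
    have m6 : 0 <= mu * M2 * z.1 by rewrite !mulr_ge0 // ltW.
    rewrite prod_normE ge_max !ler_norml.
    by apply/andP; split; apply/andP; split; lra.
  - move=> t z Tt zw; have [+ _] := Vb t z Tt zw; have [z0 _ _ _] := zw.
    rewrite ler_norml => /andP[v1 v2].
    have : eta * z.1 <= kappa * z.1 by apply: ler_wpM2r => //; lra.
    by move=> ek; apply/andP; split; lra.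
  - move=> t x Tt x0 xe.
    have zw : wedge M1 M2 eps (x, M1 * x) by split => //=; nra.
    have [_] := Vb t _ Tt zw; rewrite ler_norml => /andP[/= v1 _].
    have : eta * x <= mu * M1 * x by apply: ler_wpM2r.
    move: v1; set v := (X in _ <= X - _) => v1 ?; change (0 <= v); lra.
  - move=> t x Tt x0 xe.
    have zw : wedge M1 M2 eps (x, - M2 * x) by split => //=; nra.
    have [_] := Vb t _ Tt zw; rewrite ler_norml => /andP[/= _ v1].
    have : eta * x <= mu * M2 * x by apply: ler_wpM2r.
    move: v1; set v := (X in X - _ <= _) => v1 ?; change (v <= 0); lra.
pose X t := (Z t).1; pose Y t := (Z t).2.
have dX t : T <= t -> is_derive t 1 X (V (t, Z t)).1.
  by move=> /dZ /is_derive_fst.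
have dY t : T <= t -> is_derive t 1 Y (V (t, Z t)).2.
  by move=> /dZ /is_derive_snd.
have XYw t : T <= t ->
    [/\ 0 <= X t, X t <= eps, - M2 * X t <= Y t & Y t <= M1 * X t].
  by move=> /Zw[].
have Xdecay := exp_decay (c := kappa - delta) dX.
have {}Xdecay t : T <= t -> X t <= eps * expR (- (kappa - delta) * (t - T)).
  move=> Tt; rewrite -ZT; apply: Xdecay => // s Ts.
  have [+ _] := Vb s _ Ts (Zw s Ts); have [z0 _ _ _] := Zw s Ts.
  rewrite ler_norml -/(X s) => /andP[_ v2].
  have : eta * X s <= delta * X s by apply: ler_wpM2r.
  lra.
pose A := eps * expR ((kappa - delta) * T).
have A0 : 0 < A by rewrite mulr_gt0 ?expR_gt0.
have XA t : T <= t -> X t <= A * expR (- (kappa - delta) * t).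
  move=> Tt; rewrite /A -mulrA -expRD.
  have -> : (kappa - delta) * T + - (kappa - delta) * t =
     - (kappa - delta) * (t - T) by ring.
  exact: Xdecay.
have near_T : \forall t \near +oo, T <= t.
  by apply: nbhs_pinfty_ge; exact: num_real.
have OX : bigO_near +oo X (fun t => expR (- (kappa - delta) * t)).
  exists A => //; apply: filterS near_T => t Tt.
  by have [X0 _ _ _] := XYw t Tt; rewrite !ger0_norm ?expR_ge0 ?XA.
have OY : bigO_near +oo Y (fun t => expR (- (kappa - delta) * t)).
  exists ((M1 + M2) * A); first by rewrite mulr_gt0 //; lra.
  apply: filterS near_T => t Tt; have [X0 _ dn up] := XYw t Tt.
  rewrite [X in _ <= _ * X]ger0_norm ?expR_ge0 //.
  have YX : `|Y t| <= (M1 + M2) * X t.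
    by rewrite ler_norml; apply/andP; split; nra.
  apply: (le_trans YX); rewrite -mulrA ler_pM2l; last by lra.
  exact: XA.
have c'0 : 0 < kappa - delta by lra.
exists X, Y; split=> //.
- move=> t Tt; rewrite /X /Y -surjective_pairing.
  by split; [exact: dX|exact: dY].
- by apply: (@cvg_pair _ _ _ _ (nbhs (0 : R)) (nbhs (0 : R)));
    [exact: bigO_exp_cvg0 OX|exact: bigO_exp_cvg0 OY].
Unshelve. all: by end_near. Qed.
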